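(* Let $d\ge1$ and let $\mathbf X$ be a random vector in $\mathbb R^d$ with law $\mathbb P$ such that $\mathbb E\|\mathbf X\|<\infty$. Then for every $\delta>0$ there exist two constants $0<c_1<c_2$ such that $$c_1\|\mathbf z\|^{-1}\le D_\delta(\mathbf z|\mathbb P)\le c_2\|\mathbf z\|^{-1}$$ when $\|\mathbf z\|$ is large enough.
   Context: $\|\cdot\|$ is the Euclidean norm and $\langle\cdot,\cdot\rangle$ the Euclidean inner product. For laws $\mathbb P,\mathbb P'$ on $\mathbb R^d$ the Wasserstein distance is $d_W(\mathbb P,\mathbb P')=\inf_\Pi\int\|\mathbf x-\mathbf y\|\,\Pi(\mathrm d\mathbf x,\mathrm d\mathbf y)\in[0,\infty]$, over all joint laws $\Pi$ with marginals $\mathbb P,\mathbb P'$. The robustified halfspace depth is $$D_\delta(\mathbf z|\mathbb P)=\inf_{\|\mathbf u\|=1}\ \sup_{\mathbb P':d_W(\mathbb P',\mathbb P)\le\delta}\mathbb P'(\{\mathbf x\in\mathbb R^d:\langle\mathbf u,\mathbf x-\mathbf z\rangle\ge0\}).$$ *)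

(* Defs.v *)
From HB Require Import structures.
From mathcomp Require Import all_boot all_order all_algebra.
From mathcomp Require Import all_classical all_reals all_analysis.
Set Implicit Arguments.
Unset Strict Implicit.
Unset Printing Implicit Defensive.
Import Order.TTheory GRing.Theory Num.Theory.
Local Open Scope classical_set_scope.
Local Open Scope ring_scope.

(* R^d is d.-tuple R: its canonical sigma-algebra is the one generated by the
   coordinate maps, i.e. the Borel sigma-algebra of R^d.  (The norm that the
   library puts on row vectors is the sup norm, not the Euclidean one.) *)
Section euclidean_space.
Variables (R : realType) (d : nat).
Implicit Types x y : d.-tuple R.

Definition vsub x y : d.-tuple R := [tuple tnth x i - tnth y i | i < d].

Definition inner x y : R := \sum_(i < d) tnth x i * tnth y i.

Definition enorm x : R := Num.sqrt (inner x x).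

Definition halfspace (u z : d.-tuple R) : set (d.-tuple R) :=
  [set x | 0 <= inner u (vsub x z)].

End euclidean_space.

Section robust_depth.
Variables (R : realType) (d : nat).
Local Open Scope ereal_scope.

Definition coupling (P P' : probability (d.-tuple R) R) :
    set (probability (d.-tuple R * d.-tuple R)%type R) :=
  [set Pi | forall A : set (d.-tuple R), measurable A ->
    pushforward Pi fst A = P A /\ pushforward Pi snd A = P' A].

Definition wasserstein (P P' : probability (d.-tuple R) R) : \bar R :=
  ereal_inf [set \int[Pi]_w (enorm (vsub w.1 w.2))%:E | Pi in coupling P P'].

Definition robust_depth (delta : R) (P : probability (d.-tuple R) R)
    (z : d.-tuple R) : \bar R :=
  ereal_inf [set ereal_sup
      [set P' (halfspace u z) |
        P' in [set P' : probability (d.-tuple R) R |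
                 wasserstein P' P <= delta%:E]]
    | u in [set u : d.-tuple R | enorm u = 1%R]].

End robust_depth.

(* Main.v *)
Require Import Defs.
From HB Require Import structures.
From mathcomp Require Import all_boot all_order all_algebra.
From mathcomp Require Import ring lra.
From mathcomp Require Import all_classical all_reals all_analysis.
From mathcomp Require Import measurable_realfun.
Set Implicit Arguments.
Unset Strict Implicit.
Unset Printing Implicit Defensive.
Import Order.TTheory GRing.Theory Num.Theory.
Local Open Scope classical_set_scope.
Local Open Scope ring_scope.

(** Write [m] for the first moment of [P].  Upper bound: by the triangle
    inequality under a coupling, every [P'] within distance [delta] of [P] has
    first moment at most [delta + m]; the halfspace through [z] with normal
    [z / |z|] lies outside the ball of radius [|z|], so Markov's inequality
    bounds its mass under [P'] by [(delta + m) / |z|].  Lower bound: every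
    halfspace through [z] contains [z], hence has mass at least [p] under
    [(1 - p) P + p \d_z], and this mixture is within [p (|z| + m)] of [P]; take
    [p = delta / (2 |z|)]. *)

Section euclidean_norm.
Variables (R : realType) (d : nat).
Implicit Types u x y : d.-tuple R.

Lemma innerC x y : inner x y = inner y x.
Proof. by apply: eq_bigr => i _; rewrite mulrC. Qed.

Lemma innerBr u x y : inner u (vsub x y) = inner u x - inner u y.
Proof.
by rewrite /inner -sumrB; apply: eq_bigr => i _; rewrite tnth_mktuple mulrBr.
Qed.

Lemma inner_ge0 x : 0 <= inner x x.
Proof. by apply: sumr_ge0 => i _; rewrite -expr2 sqr_ge0. Qed.

Lemma enorm_ge0 x : 0 <= enorm x.
Proof. exact: sqrtr_ge0. Qed.

Lemma EFin_enorm_ge0 x : (0 <= (enorm x)%:E)%E.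
Proof. by rewrite lee_fin enorm_ge0. Qed.

Lemma enorm_vsubxx x : enorm (vsub x x) = 0.
Proof.
rewrite /enorm /inner big1 ?sqrtr0// => i _.
by rewrite tnth_mktuple subrr mul0r.
Qed.

Lemma lagrange_identity x y :
  \sum_(i < d) \sum_(j < d) (tnth x i * tnth y j - tnth x j * tnth y i) ^+ 2 =
  (inner x x * inner y y - inner x y ^+ 2) *+ 2.
Proof.
rewrite mulrnBl mulr2n {2}[inner x x * _]mulrC expr2 /inner !big_distrlr/=.
rewrite -sumrMnl -big_split -sumrB; apply: eq_bigr => i _ /=.
rewrite -sumrMnl -big_split -sumrB; apply: eq_bigr => j _ /=.
by ring.
Qed.

Lemma cauchy_schwarz x y : `|inner x y| <= enorm x * enorm y.
Proof.
rewrite -sqrtr_sqr -sqrtrM ?inner_ge0// ler_wsqrtr// -subr_ge0.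
rewrite -(pmulrn_lge0 _ (ltn0Sn 1)) -lagrange_identity.
by apply: sumr_ge0 => i _; apply: sumr_ge0 => j _; exact: sqr_ge0.
Qed.

Lemma inner_unit_le u x : enorm u = 1 -> `|inner u x| <= enorm x.
Proof. by move=> u1; rewrite (le_trans (cauchy_schwarz u x))// u1 mul1r. Qed.

Lemma exists_unit_inner x : 0 < enorm x ->
  exists2 u, enorm u = 1 & inner u x = enorm x.
Proof.
move=> x0; have xN0 : enorm x != 0 by rewrite gt_eqF.
pose u := [tuple (enorm x)^-1 * tnth x i | i < d].
have innerE y : inner u y = (enorm x)^-1 * inner x y.
  by rewrite mulr_sumr; apply: eq_bigr => i _; rewrite tnth_mktuple mulrA.
have ux : inner u x = enorm x.
  by rewrite innerE -[inner x x]sqr_sqrtr ?inner_ge0// -/(enorm x) mulKf.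
by exists u; rewrite // /enorm innerE innerC ux mulVf// sqrtr1.
Qed.

Lemma enorm_le_inner x c : 0 <= c ->
  (forall u, enorm u = 1 -> inner u x <= c) -> enorm x <= c.
Proof.
move=> c0 xc; have [x0|x0] := ltP 0 (enorm x); last exact: le_trans x0 c0.
by have [u u1 <-] := exists_unit_inner x0; exact: xc.
Qed.

Lemma enorm_vsub_le x y : enorm (vsub x y) <= enorm x + enorm y.
Proof.
apply: enorm_le_inner => [|u u1]; first by rewrite addr_ge0 ?enorm_ge0.
rewrite innerBr (le_trans (ler_norm _))// (le_trans (ler_normB _ _))//.
by rewrite lerD// inner_unit_le.
Qed.

Lemma enorm_le_vsub x y : enorm x <= enorm (vsub x y) + enorm y.
Proof.
apply: enorm_le_inner => [|u u1]; first by rewrite addr_ge0 ?enorm_ge0.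
rewrite -[inner u x](subrK (inner u y)) -innerBr.
by rewrite lerD// (le_trans (ler_norm _))// inner_unit_le.
Qed.

End euclidean_norm.

#[local] Hint Resolve EFin_enorm_ge0 : core.

Section euclidean_measurability.
Variables (R : realType) (d : nat) (disp : measure_display).
Variables (T : measurableType disp) (f g : T -> d.-tuple R).
Hypotheses (mf : measurable_fun setT f) (mg : measurable_fun setT g).

Lemma measurable_vsub : measurable_fun setT (fun t => vsub (f t) (g t)).
Proof.
apply/measurable_fun_tnthP => i.
apply: (eq_measurable_fun (fun t => tnth (f t) i - tnth (g t) i)).
  by move=> t _; rewrite /= tnth_mktuple.
by apply: measurable_funB; exact: measurableT_comp (measurable_tnth i) _.
Qed.

Lemma measurable_inner : measurable_fun setT (fun t => inner (f t) (g t)).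
Proof.
apply: measurable_sum => i.
by apply: measurable_funM; exact: measurableT_comp (measurable_tnth i) _.
Qed.

End euclidean_measurability.

Lemma measurable_enorm (R : realType) (d : nat) (disp : measure_display)
    (T : measurableType disp) (f : T -> d.-tuple R) :
  measurable_fun setT f -> measurable_fun setT (fun t => enorm (f t)).
Proof.
move=> mf; apply: measurableT_comp (measurable_inner mf mf) => //.
by apply: continuous_measurable_fun; exact: sqrt_continuous.
Qed.

Lemma measurable_EFin_enorm (R : realType) (d : nat) (disp : measure_display)
    (T : measurableType disp) (f : T -> d.-tuple R) :
  measurable_fun setT f -> measurable_fun setT (fun t => (enorm (f t))%:E).
Proof. by move=> mf; exact/measurable_EFinP/measurable_enorm. Qed.

Lemma measurable_halfspace (R : realType) (d : nat) (u z : d.-tuple R) :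
  measurable (halfspace u z).
Proof.
rewrite -[halfspace u z]setTI; apply: measurable_fun_le => //.
by apply: measurable_inner => //; exact: measurable_vsub.
Qed.

Section mixture.
Variables (R : realType) (disp : measure_display) (T : measurableType disp).
Variables (p : {i01 R}) (P0 P1 : probability T R).
Local Open Scope ereal_scope.

Definition mixture : set T -> \bar R :=
  measure_add (mscale (1 - p%:num)%:nng%R P0) (mscale p%:num%:nng%R P1).

HB.instance Definition _ := Measure.on mixture.

Lemma mixtureE A : mixture A = (1 - p%:num)%:E * P0 A + p%:num%:E * P1 A.
Proof. by rewrite /mixture measure_addE. Qed.

Let mixture_setT : mixture setT = 1.
Proof. by rewrite mixtureE !probability_setT !mule1 -EFinD subrK. Qed.

HB.instance Definition _ :=
  Measure_isProbability.Build _ _ _ mixture mixture_setT.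

Lemma ge0_integral_mixture (f : T -> \bar R) :
  measurable_fun setT f -> (forall x, 0 <= f x) ->
  \int[mixture]_x f x =
    (1 - p%:num)%:E * \int[P0]_x f x + p%:num%:E * \int[P1]_x f x.
Proof.
by move=> mf f0; rewrite ge0_integral_measure_add// !ge0_integral_mscale.
Qed.

End mixture.

Lemma mixturexx (R : realType) (disp : measure_display)
    (T : measurableType disp) (p : {i01 R}) (P : probability T R) (A : set T) :
  mixture p P P A = P A.
Proof.
by rewrite mixtureE -ge0_muleDl ?lee_fin// -?EFinD ?subrK ?mul1e// subr_ge0.
Qed.

Section diagonal.
Variables (disp : measure_display) (T : measurableType disp).

Definition diagonal (x : T) : T * T := (x, x).

Let measurable_diagonal : measurable_fun setT diagonal.
Proof. exact: measurable_fun_pair. Qed.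

HB.instance Definition _ :=
  isMeasurableFun.Build _ _ _ _ diagonal measurable_diagonal.

End diagonal.

Arguments diagonal {disp T}.

Lemma ge0_integral_eq_pushforward (R : realType) (d1 d2 : measure_display)
    (T1 : measurableType d1) (T2 : measurableType d2)
    (mu : {measure set T1 -> \bar R}) (nu : {measure set T2 -> \bar R})
    (phi : T1 -> T2) (f : T2 -> \bar R) :
  measurable_fun setT phi ->
  (forall A, measurable A -> pushforward mu phi A = nu A) ->
  measurable_fun setT f -> (forall y, 0 <= f y)%E ->
  (\int[nu]_y f y = \int[mu]_x f (phi x))%E.
Proof.
move=> mphi munu mf f0.
rewrite -[RHS](ge0_integral_pushforward mphi mu measurableT mf)//.
by apply: eq_measure_integral => A mA _; rewrite -munu.
Qed.

Section coupling.
Variables (R : realType) (d : nat).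
Local Notation E := (d.-tuple R).
Implicit Types (P : probability E R) (Pi : probability (E * E)%type R).
Local Open Scope ereal_scope.

Lemma coupling_diagonal P : coupling P P (distribution P diagonal).
Proof. by []. Qed.

Lemma coupling_product P P' : coupling P P' (P \x P').
Proof.
move=> A mA; rewrite /pushforward -setXT -setTX; split.
- by rewrite [LHS]product_measure1E// [X in _ * X]probability_setT mule1.
- by rewrite [LHS]product_measure1E// [X in X * _]probability_setT mul1e.
Qed.

Lemma coupling_mixture p P0 P0' Pi0 P1 P1' Pi1 :
  coupling P0 P0' Pi0 -> coupling P1 P1' Pi1 ->
  coupling (mixture p P0 P1) (mixture p P0' P1') (mixture p Pi0 Pi1).
Proof.
move=> PPi0 PPi1 A mA; rewrite /pushforward/= !mixtureE.
by case: (PPi0 A mA) (PPi1 A mA) => <- <- [<- <-].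
Qed.

End coupling.

Section first_moment.
Variables (R : realType) (d : nat).
Local Notation E := (d.-tuple R).
Implicit Types P : probability E R.
Local Open Scope ereal_scope.

Definition first_moment P : \bar R := \int[P]_x (enorm x)%:E.

Lemma first_moment_ge0 P : 0 <= first_moment P.
Proof. exact: integral_ge0. Qed.

Lemma first_moment_dirac (z : E) : first_moment \d_z = (enorm z)%:E.
Proof.
rewrite /first_moment integral_dirac ?diracT ?mul1e//.
exact: measurable_EFin_enorm.
Qed.

Lemma first_moment_distribution (disp : measure_display)
    (Omega : measurableType disp) (Q : probability Omega R)
    (X : {RV Q >-> E}) :
  first_moment (distribution Q X) = 'E_Q[fun w => enorm (X w)].
Proof.
rewrite unlock /first_moment ge0_integral_distribution//.
exact: measurable_EFin_enorm.
Qed.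

Lemma markov_halfspace P u z : enorm u = 1%R -> (0 < inner u z)%R ->
  (inner u z)%:E * P (halfspace u z) <= first_moment P.
Proof.
move=> u1 uz0; have mH := measurable_halfspace u z.
have mE := measurable_EFin_enorm (@measurable_id _ E setT).
rewrite -integral_cst//.
apply: (@le_trans _ _ (\int[P]_(x in halfspace u z) (enorm x)%:E)).
  apply: ge0_le_integral => //; last 2 first.
  - exact: measurable_funTS.
  - move=> x; rewrite /halfspace/= innerBr subr_ge0 lee_fin => uzx.
    by rewrite (le_trans uzx)// (le_trans (ler_norm _))// inner_unit_le.
  by move=> x _; rewrite lee_fin ltW.
exact: ge0_subset_integral.
Qed.

End first_moment.

Section wasserstein.
Variables (R : realType) (d : nat).
Local Notation E := (d.-tuple R).
Implicit Types (P N : probability E R) (Pi : probability (E * E)%type R).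
Local Open Scope ereal_scope.

Definition transport_cost Pi : \bar R :=
  \int[Pi]_w (enorm (vsub w.1 w.2))%:E.

Let measurable_dist :
  measurable_fun setT (fun w : E * E => (enorm (vsub w.1 w.2))%:E).
Proof. exact/measurable_EFin_enorm/measurable_vsub. Qed.

Let measurable_fst_norm :
  measurable_fun setT (fun w : E * E => (enorm w.1)%:E).
Proof. exact: measurable_EFin_enorm. Qed.

Let measurable_snd_norm :
  measurable_fun setT (fun w : E * E => (enorm w.2)%:E).
Proof. exact: measurable_EFin_enorm. Qed.

Lemma first_moment_fst P P' Pi : coupling P P' Pi ->
  first_moment P = \int[Pi]_w (enorm w.1)%:E.
Proof.
move=> PPi; apply: ge0_integral_eq_pushforward => // [A mA|].
  exact: (PPi A mA).1.
exact: measurable_EFin_enorm.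
Qed.

Lemma first_moment_snd P P' Pi : coupling P P' Pi ->
  first_moment P' = \int[Pi]_w (enorm w.2)%:E.
Proof.
move=> PPi; apply: ge0_integral_eq_pushforward => // [A mA|].
  exact: (PPi A mA).2.
exact: measurable_EFin_enorm.
Qed.

Lemma transport_cost_ge0 Pi : 0 <= transport_cost Pi.
Proof. exact: integral_ge0. Qed.

Lemma transport_cost_diagonal P : transport_cost (distribution P diagonal) = 0.
Proof.
rewrite /transport_cost ge0_integral_distribution//.
by apply: integral0_eq => x _ /=; rewrite enorm_vsubxx.
Qed.

Lemma transport_cost_le_first_moment P P' Pi : coupling P P' Pi ->
  transport_cost Pi <= first_moment P + first_moment P'.
Proof.
move=> PPi; rewrite (first_moment_fst PPi) (first_moment_snd PPi).
rewrite -ge0_integralD//; apply: ge0_le_integral => //.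
- exact: emeasurable_funD.
- by move=> w _; rewrite -EFinD lee_fin enorm_vsub_le.
Qed.

Lemma first_moment_le_transport_cost P P' Pi : coupling P P' Pi ->
  first_moment P <= transport_cost Pi + first_moment P'.
Proof.
move=> PPi; rewrite (first_moment_fst PPi) (first_moment_snd PPi).
rewrite -ge0_integralD//; apply: ge0_le_integral => //.
- exact: emeasurable_funD.
- by move=> w _; rewrite -EFinD lee_fin enorm_le_vsub.
Qed.

Lemma wasserstein_ge0 P P' : 0 <= wasserstein P P'.
Proof. by apply/ereal_infP => _ [Pi _ <-]; exact: transport_cost_ge0. Qed.

Lemma wasserstein_le_transport_cost P P' Pi :
  coupling P P' Pi -> wasserstein P P' <= transport_cost Pi.
Proof. by move=> PPi; apply: ereal_inf_lbound; exists Pi. Qed.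

Lemma first_moment_le_wasserstein P P' :
  first_moment P <= wasserstein P P' + first_moment P'.
Proof.
have [P'fin|] := boolP (first_moment P' \is a fin_num).
  rewrite -leeBlDr//; apply/ereal_infP => _ [Pi PPi <-].
  by rewrite leeBlDr//; exact: first_moment_le_transport_cost.
rewrite ge0_fin_numE ?first_moment_ge0// -leNgt leye_eq => /eqP ->.
by rewrite addey ?leey// gt_eqF// (lt_le_trans _ (wasserstein_ge0 P P')).
Qed.

Lemma wasserstein_mixture p P N :
  wasserstein (mixture p P N) P <=
  p%:num%:E * (first_moment N + first_moment P).
Proof.
pose Pi := mixture p (distribution P diagonal) (N \x P).
have PPi : coupling (mixture p P N) P Pi.
  move=> A mA; rewrite -[P A](mixturexx p).
  exact: (coupling_mixture p (coupling_diagonal P) (coupling_product N P)).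
apply: le_trans (wasserstein_le_transport_cost PPi) _.
rewrite /transport_cost ge0_integral_mixture//.
rewrite [X in _ * X + _]transport_cost_diagonal mule0 add0e lee_wpmul2l//.
exact/transport_cost_le_first_moment/coupling_product.
Qed.

End wasserstein.

Section robust_depth_bounds.
Variables (R : realType) (d : nat) (delta : R) (P : probability (d.-tuple R) R).
Implicit Types z : d.-tuple R.
Local Open Scope ereal_scope.

Lemma robust_depth_le z : (0 < enorm z)%R ->
  (enorm z)%:E * robust_depth delta P z <= delta%:E + first_moment P.
Proof.
move=> z0; have [u u1 uz] := exists_unit_inner z0.
rewrite -lee_pdivlMl//; apply: ge_ereal_inf; eexists; first by exists u.
apply: ge_ereal_sup => _ [P' /= P'P <-].
rewrite lee_pdivlMl// -uz (le_trans (markov_halfspace P' u1 _)) ?uz//.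
by rewrite (le_trans (first_moment_le_wasserstein P' P))// leeD2r.
Qed.

Lemma robust_depth_ge (p : {i01 R}) z :
  p%:num%:E * ((enorm z)%:E + first_moment P) <= delta%:E ->
  p%:num%:E <= robust_depth delta P z.
Proof.
move=> cost; apply/ereal_infP => _ [u _ <-].
pose N := mixture p P \d_z.
have NP : wasserstein N P <= delta%:E.
  by rewrite (le_trans (wasserstein_mixture _ _ _))// first_moment_dirac.
apply: (@le_trans _ _ (N (halfspace u z))); last first.
  by apply: ereal_sup_ubound; exists N.
have zH : halfspace u z z by rewrite /halfspace/= innerBr subrr.
rewrite /N/= mixtureE [X in _ + _ * X]diracE mem_set// mule1.
by rewrite leeDr// mule_ge0.
Qed.

End robust_depth_bounds.

Theorem corollary2 (R : realType) (d : nat) (hd : (1 <= d)%N)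
    (disp : measure_display) (Omega : measurableType disp)
    (Q : probability Omega R) (X : {RV Q >-> d.-tuple R})
    (hX : ('E_Q[fun w => enorm (X w)] < +oo)%E)
    (delta : R) (hdelta : 0 < delta) :
  exists c1 c2 : R,
    [/\ 0 < c1, c1 < c2 &
      exists r : R, forall z : d.-tuple R, r <= enorm z ->
        ((c1 * (enorm z)^-1)%:E <= robust_depth delta (distribution Q X) z /\
         robust_depth delta (distribution Q X) z <= (c2 * (enorm z)^-1)%:E)%E].
Proof.
pose P := distribution Q X; pose m := fine (first_moment P).
have mE : first_moment P = m%:E.
  by rewrite fineK// ge0_fin_numE ?first_moment_ge0// first_moment_distribution.
have m0 : 0 <= m by rewrite fine_ge0// first_moment_ge0.
exists (delta / 2), (delta + m); split; [lra|lra|].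
exists (delta + m) => z zlarge; have z0 : 0 < enorm z by lra.
split.
- have p0 : 0 <= delta / 2 * (enorm z)^-1 by rewrite !divr_ge0 ?enorm_ge0 ?ltW.
  have p1 : delta / 2 * (enorm z)^-1 <= 1 by rewrite ler_pdivrMr//; lra.
  apply: (robust_depth_ge (p := Itv01 p0 p1)).
  by rewrite mE -EFinD -EFinM lee_fin/= mulrAC ler_pdivrMr//; nra.
- rewrite mulrC EFinM lee_pdivlMl// EFinD -mE; exact: robust_depth_le.
Qed.
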